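(* Let $d_1\ge d\ge1$, let $\Lambda=\{l_1,\dots,l_{d_1}\}\subset\mathbb{Z}^d$ with $l_k=e_k$ for $k=1,\dots,d$, let $0<\delta_1^*\le\delta_2^*$, and let $\lambda_1,\dots,\lambda_{d_1}:\mathbb{Z}\to[\delta_1^*,\delta_2^*]$ be deterministic functions. Put $a^{ij}(t)=\sum_{k=1}^{d_1}\lambda_k(t)l_k^il_k^j$, and assume that there are $\delta_1,\delta_2>0$ such that $\delta_1|\xi|^2\le\sum_{i,j}a^{ij}(t)\xi^i\xi^j\le\delta_2|\xi|^2$ for all $t$ and $\xi\in\mathbb{R}^d$. Let $\rho\in(0,(2d_1\delta_2^* )^{-1})$, and let $G$ be the discrete heat kernel defined in the context. Let $g:\mathbb{Z}^{d+1}\to\mathbb{R}$ be a deterministic function with compact (i.e. finite) support. Then for any $p\ge2$ and any $k\in\{1,\dots,d\}$, $$\sum_{n\in\mathbb{Z}}\ \sum_{x\in\mathbb{Z}^d}\Big(\sum_{j=-\infty}^{n-1}\big|\big(\delta_{e_k,1}G(j,n,\cdot)\ast_1 g(j,\cdot)\big)(x)\big|^2\Big)^{p/2}\le N\sum_{(t,x)\in\mathbb{Z}^{d+1}}|g(t,x)|^p,$$ where $N$ depends only on $p,d,d_1,\delta_1^*,\delta_2^*,\Lambda,\rho$.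
   Context: $e_1,\dots,e_d$ is the standard basis of $\mathbb{R}^d$. For a function $f$ on $\mathbb{Z}^d$ and $\xi\in\mathbb{Z}^d$: $\delta_{\xi,1}f(x)=f(x+\xi)-f(x)$, $\Delta_{\xi,1}f(x)=f(x+\xi)-2f(x)+f(x-\xi)$; $(f\ast_1g)(x)=\sum_{y\in\mathbb{Z}^d}f(x-y)g(y)$. For each $m\in\mathbb{Z}$, $G(m,\cdot,\cdot)$ is the solution $z(n,y)$ of $$z(n+1,y)-z(n,y)=\rho\sum_{k=1}^{d_1}\lambda_k(n)\Delta_{l_k,1}z(n,y),\quad z(m,y)=I_{y=0},\quad n\in[m,\infty)\cap\mathbb{Z},\ y\in\mathbb{Z}^d.$$ In $\delta_{e_k,1}G(j,n,\cdot)$ the difference acts in the spatial variable. *)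

(* Defs.v *)
From HB Require Import structures.
From mathcomp Require Import all_boot all_order all_algebra.
From mathcomp Require Import all_classical all_reals all_analysis.
Set Implicit Arguments.
Unset Strict Implicit.
Unset Printing Implicit Defensive.
Import Order.TTheory GRing.Theory Num.Theory.
Local Open Scope classical_set_scope.
Local Open Scope ring_scope.

Section Lattice.
Context {R : realType} {d : nat}.
Implicit Types (f g : 'rV[int]_d -> R) (x y xi : 'rV[int]_d).

Definition lat_basis (k : 'I_d) : 'rV[int]_d := delta_mx 0 k.

Definition lat_diff xi f x : R := f (x + xi) - f x.

Definition lat_diff2 xi f x : R := f (x + xi) - 2 * f x + f (x - xi).

(* The sum is a finitely supported one, which by convention is 0 if
   infinitely many terms are nonzero; it is the usual convolution as soon as
   f or g has finite support. *)
Definition lat_conv f g x : R :=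
  \sum_(y \in [set: 'rV[int]_d]) f (x - y) * g y.

(* [G m n y]: only the values at times n >= m are constrained. *)
Definition heat_kernel (d1 : nat) (l : 'I_d1 -> 'rV[int]_d)
    (lam : 'I_d1 -> int -> R) (rho : R) (G : int -> int -> 'rV[int]_d -> R) :=
  forall m : int,
    (forall y, G m m y = (y == 0)%:R) /\
    (forall (n : int) y, m <= n ->
      G m (n + 1) y - G m n y =
        rho * \sum_(k < d1) lam k n * lat_diff2 (l k) (G m n) y).

Definition diffusion (d1 : nat) (l : 'I_d1 -> 'rV[int]_d)
    (lam : 'I_d1 -> int -> R) (t : int) : 'M[R]_d :=
  \matrix_(i, j) \sum_(k < d1) lam k t * (l k 0 i)%:~R * (l k 0 j)%:~R.

(* The norm of xi is Euclidean, not the library's sup norm on matrices. *)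
Definition elliptic (a : int -> 'M[R]_d) (delta1 delta2 : R) :=
  forall (t : int) (xi : 'rV[R]_d),
    delta1 * (\sum_i xi 0 i ^+ 2) <= \sum_i \sum_j a t i j * xi 0 i * xi 0 j
      <= delta2 * (\sum_i xi 0 i ^+ 2).

Lemma heat_kernel_exists (d1 : nat) (l : 'I_d1 -> 'rV[int]_d)
    (lam : 'I_d1 -> int -> R) (rho : R) : exists G, heat_kernel l lam rho G.
Proof.
exists (fun m n => iteri (absz (n - m)%R)
  (fun i z y => z y + rho * \sum_(k < d1)
    lam k (m + i%:Z) * lat_diff2 (l k) z y)
  (fun y => (y == 0)%:R)) => m; split=> [y|n y mn]; first by rewrite subrr.
have -> : absz (n + 1 - m)%R = (absz (n - m)%R).+1.
  apply/eqP; rewrite -eqz_nat -addn1 PoszD !gez0_abs ?subr_ge0 //.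
    by rewrite addrAC.
  by rewrite (le_trans mn)// lerDl.
rewrite /= addrAC subrr add0r gez0_abs ?subr_ge0//.
by rewrite addrC subrK.
Qed.

End Lattice.

(* Main.v *)
Require Import Defs.
From mathcomp Require Import all_boot all_order all_algebra.
From mathcomp Require Import all_classical all_reals all_analysis.
From mathcomp Require Import finmap ring lra zify.
Set Implicit Arguments.
Unset Strict Implicit.
Unset Printing Implicit Defensive.
Import Order.TTheory GRing.Theory Num.Theory.
Local Open Scope classical_set_scope.
Local Open Scope ring_scope.

(* Let P_n be the one-step operator of the lazy symmetric walk, so that
   u_j(n) := G(j,n,.) * g(j,.) satisfies u_j(n+1) = P_n u_j(n), and put e := e_k,
   b_j(n) := |delta_e u_j(n)|^2, v_j(n)(x) := u_j(n)(x)^2 + u_j(n)(x+e)^2. Two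
   inequalities carry the whole argument: b_j(n+1) <= P_n b_j(n) (Jensen) and
   v_j(n+1) + c b_j(n+1) <= P_n v_j(n) (the variance of one step).

   For p = 2 summing the second one suffices. For p > 2 test A := sum_(j<n) b_j(n)
   against h := A^(p/2-1). By the first inequality b_j(n) is at most the average of
   P_(n-1)...P_s b_j(s) over the s in the second half of [j,n], so that
   sum_n <b_j(n), h_n> <= 4 sum_s <b_j(s), H_j(s)> with
     H_j(s,x) := E [ max_e 1/(e-j+1) sum_(n=s..e) h_n(X_n) | X_s = x ].
   The maximum decreases with s along each path, hence H_j(s) >= P_s H_j(s+1), and
   the second inequality, weighted by H_j, bounds this by (4/c) <v_j(j), H_j(j)>.
   Now H_j(j) is the expectation of a one-sided maximal function along a path, which
   is bounded on l^r for r = (p/2)'; since the walk preserves counting measure,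
   Young's inequality gives sum A^(p/2) <= C sum v_j(j)^(p/2) + (1/2) sum A^(p/2). *)

(** * Inequalities for real powers *)

Lemma powRM_subr1 (R : realType) (a q : R) : 0 <= a -> 1 < q ->
  a * a `^ (q - 1) = a `^ q.
Proof.
move=> a0 q1; rewrite -{1}(powRr1 a0) -powRD ?subrKC //.
by apply/implyP => /eqP q0; move: q1; rewrite q0 ltr10.
Qed.

(** Either [a <= eps * b], and the first term on the right suffices, or [b < a / eps], and the
    second does. The free [eps] serves to absorb terms later. *)
Lemma ex_young (R : realType) (q eps : R) : 1 < q -> 0 < eps ->
  exists2 C : R, 0 < C &
    forall a b, 0 <= a -> 0 <= b -> a * b `^ (q - 1) <= eps * b `^ q + C * a `^ q.
Proof.
move=> q1 e0; exists ((eps^-1) `^ (q - 1)); first by rewrite powR_gt0 ?invr_gt0.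
move=> a b a0 b0; case: (leP a (eps * b)) => ab.
  rewrite (le_trans (ler_wpM2r (powR_ge0 _ _) ab)) // -mulrA powRM_subr1 //.
  by rewrite lerDl mulr_ge0 ?powR_ge0.
have ba : b <= eps^-1 * a by rewrite ler_pdivlMl // ltW.
apply: (@le_trans _ _ (a * (eps^-1 * a) `^ (q - 1))).
  apply: ler_wpM2l => //; apply: ge0_ler_powR; rewrite ?nnegrE ?subr_ge0 //.
    exact: ltW.
  by rewrite mulr_ge0 ?invr_ge0 // ltW.
rewrite powRM ?invr_ge0 ?(ltW e0) // mulrCA powRM_subr1 //.
by rewrite lerDr mulr_ge0 ?powR_ge0 // ltW.
Qed.

(* Young's inequality [r y x^(r-1) <= y^r + (r - 1) x^r], rearranged. *)
Lemma powR_increment_le (R : realType) (r x y : R) : 1 < r -> 0 <= x -> x <= y ->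
  (r - 1) / r * (y `^ r - x `^ r) <= y * (y `^ (r - 1) - x `^ (r - 1)).
Proof.
move=> r1 x0 xy; have y0 := le_trans x0 xy.
have r0 : 0 < r by rewrite (lt_trans _ r1).
have s0 : 0 < r - 1 by rewrite subr_gt0.
have := @conjugate_powR R y (x `^ (r - 1)) r (r / (r - 1)) y0 (powR_ge0 _ _) r0
  (divr_gt0 r0 s0).
have -> : r^-1 + (r / (r - 1))^-1 = 1 by field; rewrite !gt_eqF.
move=> /(_ erefl); rewrite -powRrM (_ : (r - 1) * (r / (r - 1)) = r); last first.
  by field; rewrite gt_eqF.
move=> H; rewrite [leRHS]mulrBr powRM_subr1 //.
have -> : (r - 1) / r * (y `^ r - x `^ r) =
  y `^ r - (y `^ r / r + x `^ r / (r / (r - 1))).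
  by field; rewrite !gt_eqF.
by rewrite lerB.
Qed.

(** A discrete layer-cake argument: only the positive values of [F] matter as levels, so the
    integral over [lam] becomes a telescoping sum, and [powR_increment_le] compares the increments
    of the two powers. *)
Lemma weak_type_powR (R : realType) (T : eqType) (s : seq T) (F h : T -> R) (r : R) :
  1 < r -> {in s, forall i, 0 <= F i} ->
  (forall lam, 0 < lam ->
    \sum_(i <- s | lam <= F i) lam <= \sum_(i <- s | lam <= F i) h i) ->
  (r - 1) / r * \sum_(i <- s) F i `^ r <= \sum_(i <- s) h i * F i `^ (r - 1).
Proof.
move=> r1 F0 weak.
have r0 : 0 < r by rewrite (lt_trans _ r1).
have s0 : 0 < r - 1 by rewrite subr_gt0.
pose m x i := Num.max (F i) x.
have levels t : forall x0, 0 <= x0 -> path <%R x0 t ->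
    (forall i, i \in s -> F i <= x0 \/ F i \in t) ->
    (r - 1) / r * \sum_(i <- s) (m x0 i `^ r - x0 `^ r) <=
      \sum_(i <- s) h i * (m x0 i `^ (r - 1) - x0 `^ (r - 1)).
  elim: t => [|y t IH] x0 x00 /=.
    move=> _ Ft; rewrite !big_seq !big1 ?mulr0 // => i /Ft [] // Fx.
      by rewrite /m max_r // subrr mulr0.
    by rewrite /m max_r // subrr.
  case/andP => x0y yt Ft.
  have y0 : 0 < y by apply: le_lt_trans x00 x0y.
  have dich i : i \in s -> F i <= x0 \/ y <= F i.
    case/Ft => [|]; first by left.
    rewrite inE => /orP[/eqP ->|Fit]; first by right.
    right; move: yt; rewrite lt_path_sortedE => /andP[/allP ya _].
    exact: ltW (ya _ Fit).
  have Ft' i : i \in s -> F i <= y \/ F i \in t.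
    case/Ft => [Fx|]; first by left; apply: le_trans Fx (ltW x0y).
    by rewrite inE => /orP[/eqP ->|Fit]; [left|right].
  (* No value of [F] lies strictly between [x0] and [y], so raising the base level to [y] splits off
     one increment, carried exactly by the [i] with [y <= F i]. *)
  have split1 e i : i \in s -> m x0 i `^ e - x0 `^ e =
      (m y i `^ e - y `^ e) + (if y <= F i then y `^ e - x0 `^ e else 0).
    case/dich => Fi; rewrite /m.
      have Fy : F i < y by apply: le_lt_trans Fi x0y.
      by rewrite leNgt Fy /= !max_r ?subrr ?addr0 // ltW.
    by rewrite Fi !max_l // ?(le_trans _ Fi) ?(ltW x0y) // subrKA.
  rewrite (eq_big_seq _ (split1 r)) big_split /= mulrDr.
  rewrite (eq_big_seq _ (fun i si => congr1 (fun z => h i * z) (split1 (r - 1) i si))).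
  under [X in _ <= X]eq_bigr do rewrite mulrDr.
  rewrite [X in _ <= X]big_split /= lerD ?IH // ?(ltW y0) //.
  rewrite -big_mkcond /=.
  have -> : \sum_(i <- s) h i * (if y <= F i then y `^ (r - 1) - x0 `^ (r - 1) else 0)
    = (y `^ (r - 1) - x0 `^ (r - 1)) * \sum_(i <- s | y <= F i) h i.
    rewrite mulr_sumr [RHS]big_mkcond /=; apply: eq_bigr => i _.
    by case: ifP; rewrite ?mulr0 // mulrC.
  have d0 : 0 <= y `^ (r - 1) - x0 `^ (r - 1).
    by rewrite subr_ge0 ge0_ler_powR // ?nnegrE ?(ltW y0) ?(ltW s0) // ltW.
  apply: le_trans (ler_wpM2l d0 (weak _ y0)).
  rewrite !mulr_sumr; apply: ler_sum => i _.
  by rewrite [leRHS]mulrC powR_increment_le // ltW.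
pose t := sort <=%R (undup [seq x <- [seq F i | i <- s] | 0 < x]).
have ts : path <%R 0 t.
  rewrite lt_path_sortedE; apply/andP; split.
    by apply/allP => z; rewrite mem_sort mem_undup mem_filter => /andP[].
  by rewrite sort_lt_sorted undup_uniq.
have /(levels _ _ (lexx 0) ts) : forall i, i \in s -> F i <= 0 \/ F i \in t.
  move=> i si; case: (leP (F i) 0) => F1; [by left|right].
  by rewrite mem_sort mem_undup mem_filter F1 map_f.
rewrite !powR0 ?gt_eqF // => H; move: H.
under eq_big_seq => i si do rewrite subr0 /m max_l ?F0 //.
by under [X in _ <= X]eq_big_seq => i si do rewrite subr0 /m max_l ?F0 //.
Qed.

(** * Maximal averages along a finite sequence *)

Fixpoint tails (T : Type) (v : seq T) : seq (seq T) :=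
  if v is y :: v' then v :: tails v' else [::].

(* [max_avg a S v] is the largest of [(S + v_0 + ... + v_e) / (a + e + 1)]; for
   [S = 0] and [a = s - j] it is the largest average over a window starting at
   time [j] of a function that vanishes before time [s]. *)
Fixpoint max_avg (R : realType) (a : nat) (S : R) (v : seq R) : R :=
  if v is y :: v' then Num.max ((S + y) / a.+1%:R) (max_avg a.+1 (S + y) v')
  else 0.

Section MaxAvg.
Context {R : realType}.
Implicit Types (v : seq R) (S lam r : R).

Definition nneg_seq v := all (fun y => 0 <= y) v.

Lemma max_avg_ge0 a S v : 0 <= S -> nneg_seq v -> 0 <= max_avg a S v.
Proof.
elim: v a S => //= y v IH a S S0 /andP[y0 v0].
by rewrite le_max divr_ge0 ?addr_ge0 ?ler0n.
Qed.

Lemma le_max_avg a S S' v : S <= S' -> max_avg a S v <= max_avg a S' v.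
Proof.
elim: v a S S' => //= y v IH a S S' SS.
rewrite ge_max !le_max ler_pM2r ?invr_gt0 ?ltr0n // lerD2r SS /=.
by rewrite IH ?orbT // lerD2r.
Qed.

Lemma max_avg_behead a y v : 0 <= y -> max_avg a.+1 0 v <= max_avg a 0 (y :: v).
Proof. by move=> y0; rewrite /= add0r le_max le_max_avg ?orbT. Qed.

(** As long as [m] stays within [v], the sum over [a + m] is one of the averages; past the end [nth]
    returns 0, so the sum stops growing while the denominator still grows. *)
Lemma sum_le_max_avg a v m : nneg_seq v ->
  \sum_(i < m) nth 0 v i <= (a + m)%:R * max_avg a 0 v.
Proof.
have gen y v' : forall a S m, 0 <= S -> nneg_seq (y :: v') ->
    S + \sum_(i < m.+1) nth 0 (y :: v') i <=
    (a + m.+1)%:R * max_avg a S (y :: v').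
  elim: v' y => [|z v' IH] y a' S m' S0.
    move=> /= /andP[y0 _]; rewrite big_ord_recl big1 ?addr0; last first.
      by move=> i _; rewrite /= nth_nil.
    have Sy : 0 <= S + y by rewrite addr_ge0.
    rewrite max_l ?divr_ge0 ?ler0n // mulrA ler_pdivlMr ?ltr0n //.
    by rewrite mulrC ler_wpM2r // ler_nat addnS ltnS leq_addr.
  case/andP => y0 zv0; have Sy : 0 <= S + y by rewrite addr_ge0.
  rewrite big_ord_recl addrA [nth _ _ _]/=; case: m' => [|m'].
    rewrite big_ord0 addr0 addn1 -ler_pdivrMl ?ltr0n // mulrC.
    by rewrite /= le_max lexx.
  apply: le_trans (IH z a'.+1 (S + y) m' Sy zv0) _.
  rewrite addSnnS ler_wpM2l ?ler0n //=.
  by rewrite [X in _ <= X]/= le_max lexx orbT.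
case: v => [|y v] v0; last first.
  case: m => [|m]; last by rewrite -[leLHS]add0r gen.
  by rewrite big_ord0 mulr_ge0 ?ler0n // max_avg_ge0.
by rewrite /= mulr0 big1 // => i _; rewrite nth_nil.
Qed.

(** The largest sum of [v_i - lam] over the prefixes of [v], the empty one included. *)
Fixpoint pos_part_sum lam v : R :=
  if v is y :: v' then Num.max 0 (y - lam + pos_part_sum lam v') else 0.

Lemma pos_part_sum_ge0 lam v : 0 <= pos_part_sum lam v.
Proof. by case: v => //= y v; rewrite le_max lexx. Qed.

(** A window has average at least [lam] iff its excesses over [lam] have nonnegative sum;
    [S - lam * a] is the excess accumulated before [y]. As [lam > 0], the value 0 of [max_avg] on
    the empty list never counts. *)
Lemma ge_max_avgE lam a S y v : 0 < lam ->
  (lam <= max_avg a S (y :: v)) =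
  (0 <= S - lam * a%:R + (y - lam) + pos_part_sum lam v).
Proof.
move=> lam0.
have step a' S' y' : (lam <= (S' + y') / a'.+1%:R) = (0 <= S' - lam * a'%:R + (y' - lam)).
  rewrite ler_pdivlMr ?ltr0n // -subr_ge0 -[a'.+1]addn1 natrD.
  by congr (0 <= _); ring.
elim: v y a S => [|z v IH] y a S.
  rewrite [max_avg _ _ _]/= le_max step [lam <= 0]leNgt lam0 orbF /=.
  by rewrite addr0.
rewrite [max_avg _ _ _]/= -/(max_avg a.+1 (S + y) (z :: v)) le_max step IH.
have -> : S + y - lam * a.+1%:R = S - lam * a%:R + (y - lam).
  by rewrite -[a.+1]addn1 natrD; ring.
set A := S - _ + _; rewrite [pos_part_sum _ (z :: v)]/= -addrA.
set B := z - lam + _; rewrite addr_maxr addr0 le_max //.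
Qed.

(* The discrete rising sun lemma. *)
Lemma max_avg_weak_type lam v : 0 < lam ->
  \sum_(w <- tails v | lam <= max_avg 0 0 w) lam <=
  \sum_(w <- tails v | lam <= max_avg 0 0 w) head 0 w.
Proof.
move=> lam0; rewrite -subr_ge0 -sumrB.
(* Induction needs a bound better than 0: by [ge_max_avgE] a suffix is selected exactly when the
   recursion of [pos_part_sum] adds [y - lam], and otherwise that recursion resets to 0. *)
apply: le_trans (pos_part_sum_ge0 lam v) _.
elim: v => [|y v IH]; first by rewrite big_nil.
rewrite [tails _]/= big_cons ge_max_avgE // mulr0 subr0 add0r.
rewrite [pos_part_sum _ (y :: v)]/=; case: (leP 0 (y - _ + _)) => s0.
  by rewrite /= lerD2l.
exact: le_trans (pos_part_sum_ge0 lam v) IH.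
Qed.

Lemma mem_tails_nneg v w : nneg_seq v -> w \in tails v -> nneg_seq w.
Proof.
elim: v => //= y v IH /andP[y0 v0]; rewrite inE => /orP[/eqP ->|wv].
  by rewrite /= y0.
exact: IH.
Qed.

Lemma max_avg_strong_type r : 1 < r -> exists2 C : R, 0 < C &
  forall v, nneg_seq v ->
    \sum_(w <- tails v) max_avg 0 0 w `^ r <=
    C * \sum_(w <- tails v) head 0 w `^ r.
Proof.
move=> r1.
have r0 : 0 < r by rewrite (lt_trans _ r1).
have s0 : 0 < r - 1 by rewrite subr_gt0.
have th0 : 0 < (r - 1) / r by rewrite divr_gt0.
(* Half the constant of [weak_type_powR], so that half of [F] can be absorbed on the left. *)
have [C C0 HC] := @ex_young R r ((r - 1) / r / 2) r1 (divr_gt0 th0 (ltr0Sn _ 1)).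
exists (2 * C / ((r - 1) / r)); first by rewrite divr_gt0 // mulr_gt0.
move=> v v0; set F := \sum_(w <- _) _; set H := \sum_(w <- _) _.
have F0 w : w \in tails v -> 0 <= max_avg 0 0 w.
  by move=> /(mem_tails_nneg v0) w0; rewrite max_avg_ge0.
have h0 w : w \in tails v -> 0 <= head 0 w.
  by move=> /(mem_tails_nneg v0); case: w => //= y w /andP[].
have E1 := weak_type_powR r1 F0 (fun lam => @max_avg_weak_type lam v).
have E2 : \sum_(w <- tails v) head 0 w * max_avg 0 0 w `^ (r - 1) <=
    (r - 1) / r / 2 * F + C * H.
  rewrite !mulr_sumr -big_split /= !big_seq; apply: ler_sum => w wv.
  by rewrite HC ?F0 ?h0.
have E3 := le_trans E1 E2.
rewrite -/F in E3; set th := (r - 1) / r in th0 E3 *.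
rewrite mulrAC ler_pdivlMr // mulrC.
have -> : 2 * C * H = 2 * (C * H) by rewrite mulrA.
lra.
Qed.
End MaxAvg.

(** * Summation over the second half of a time window *)

Lemma count_half (t m : nat) : (t < m)%N ->
  (t.+1 <= (\sum_(s < m | (s <= t)%N && (t <= s.*2)%N) 1).*2)%N.
Proof.
move=> tm.
suff -> : (\sum_(s < m | (s <= t)%N && (t <= s.*2)%N) 1 =
  minn m t.+1 - minn m (uphalf t))%N by lia.
elim: m {tm} => [|m IH]; first by rewrite big_ord0 !min0n.
by rewrite big_mkcond big_ord_recr -big_mkcond /= IH; case: ifP; lia.
Qed.

Lemma ler_sum_ord_widen (R : realType) (n n' : nat) (f : nat -> R) :
  (forall i, 0 <= f i) -> (n <= n')%N -> \sum_(i < n) f i <= \sum_(i < n') f i.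
Proof.
move=> f0 nn; rewrite -(subnKC nn) big_split_ord /= lerDl.
by apply: sumr_ge0.
Qed.

(** For use after exchanging the sums: with [s] fixed, the lags [t - s] are distinct and at most
    [s]. *)
Lemma ler_sum_half_range (R : realType) (s m : nat) (f : nat -> R) :
  (forall i, 0 <= f i) ->
  \sum_(t < m | (s <= t)%N && (t <= s.*2)%N) f (t - s)%N <= \sum_(i < s.+1) f i.
Proof.
move=> f0.
have -> : \sum_(t < m | (s <= t)%N && (t <= s.*2)%N) f (t - s)%N =
    \sum_(i < minn m s.*2.+1 - s) f i.
  elim: m => [|m IH]; first by rewrite min0n !big_ord0.
  rewrite big_mkcond big_ord_recr -big_mkcond /= IH; case: ifP => sm.
    have -> : (minn m.+1 s.*2.+1 - s = (m - s).+1)%N by lia.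
    have -> : (minn m s.*2.+1 - s = m - s)%N by lia.
    by rewrite big_ord_recr.
  have -> : (minn m.+1 s.*2.+1 - s = minn m s.*2.+1 - s)%N by lia.
  by rewrite addr0.
by apply: ler_sum_ord_widen => //; lia.
Qed.

(** * Symmetric Markov chains on a finite state space *)

Section Markov.
Context {R : realType} {I : finType}.
Variable p : nat -> I -> I -> R.
Hypothesis p_ge0 : forall n x y, 0 <= p n x y.
Hypothesis p_sym : forall n x y, p n x y = p n y x.
Hypothesis p_sum1 : forall n x, \sum_y p n x y = 1.

Definition markov_op (n : nat) (f : I -> R) (x : I) : R := \sum_y p n x y * f y.

Lemma sum_markov_opC n (f g : I -> R) :
  \sum_x markov_op n f x * g x = \sum_x f x * markov_op n g x.
Proof.
under eq_bigr do rewrite mulr_suml.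
under [RHS]eq_bigr do rewrite mulr_sumr.
rewrite exchange_big; apply: eq_bigr => x _; apply: eq_bigr => y _.
by rewrite p_sym -mulrA mulrCA.
Qed.

Lemma sum_markov_op n (f : I -> R) : \sum_x markov_op n f x = \sum_x f x.
Proof.
rewrite exchange_big; apply: eq_bigr => x _.
by under eq_bigr do rewrite p_sym; rewrite -mulr_suml p_sum1 mul1r.
Qed.

Variable h : nat -> I -> R.
Hypothesis h_ge0 : forall n x, 0 <= h n x.

(* The expectation of [Phi [:: h s X_s; ...; h (s + k - 1) X_(s + k - 1)]]
   for the Markov chain started from [X_s = x]. *)
Fixpoint path_exp (k s : nat) (x : I) (Phi : seq R -> R) : R :=
  if k is k'.+1 then
    \sum_y p s x y * path_exp k' s.+1 y (fun v => Phi (h s x :: v))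
  else Phi [::].

Lemma le_path_exp k s x Phi Psi :
  (forall v, nneg_seq v -> Phi v <= Psi v) ->
  path_exp k s x Phi <= path_exp k s x Psi.
Proof.
elim: k s x Phi Psi => [|k IH] s x Phi Psi PP /=; first exact: PP.
apply: ler_sum => y _; rewrite ler_wpM2l // IH // => v v0.
by apply: PP; rewrite /= h_ge0.
Qed.

Lemma path_exp_lin k s x c c' Phi Psi :
  path_exp k s x (fun v => c * Phi v + c' * Psi v) =
  c * path_exp k s x Phi + c' * path_exp k s x Psi.
Proof.
elim: k s x Phi Psi => [//|k IH] s x Phi Psi /=.
under eq_bigr do rewrite IH mulrDr mulrCA [X in _ + X]mulrCA.
by rewrite big_split /= -!mulr_sumr.
Qed.

Lemma path_exp_cst k s x c : path_exp k s x (fun=> c) = c.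
Proof.
elim: k s x => [//|k IH] s x /=.
by under eq_bigr do rewrite IH; rewrite -mulr_suml p_sum1 mul1r.
Qed.

Lemma path_expZ k s x c Phi :
  path_exp k s x (fun v => c * Phi v) = c * path_exp k s x Phi.
Proof.
have := path_exp_lin k s x c 0 Phi (fun=> 0).
rewrite [X in _ = _ + X]mul0r addr0 => <-; congr path_exp.
by apply/funext => v; rewrite mul0r addr0.
Qed.

Lemma path_exp_ge0 k s x Phi : (forall v, nneg_seq v -> 0 <= Phi v) ->
  0 <= path_exp k s x Phi.
Proof. by move=> P0; rewrite -(path_exp_cst k s x 0) le_path_exp. Qed.

Lemma path_exp_sum k s x m (Phi : nat -> seq R -> R) :
  path_exp k s x (fun v => \sum_(i < m) Phi i v) =
  \sum_(i < m) path_exp k s x (Phi i).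
Proof.
elim: m => [|m IH].
  by rewrite big_ord0 -[RHS](path_exp_cst k s x 0); congr path_exp;
    apply/funext => v; rewrite big_ord0.
rewrite big_ord_recr /= -IH.
have := path_exp_lin k s x 1 1 (fun v => \sum_(i < m) Phi i v) (Phi m).
rewrite !mul1r => <-; congr path_exp; apply/funext => v.
by rewrite !mul1r big_ord_recr.
Qed.

(** Counting measure is invariant, so a chain started once from each [x] is again spread by counting
    measure at time [s + i]; the suffix seen there behaves as the path of a fresh chain. *)
Lemma sum_path_exp_tails k s (Psi : seq R -> R) :
  \sum_x path_exp k s x (fun v => \sum_(w <- tails v) Psi w) =
  \sum_(i < k) \sum_x path_exp (k - i) (s + i) x Psi.
Proof.
elim: k s => [|k IH] s.
  by rewrite big_ord0 big1 // => x _ /=; rewrite big_nil.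
rewrite big_ord_recl subn0 addn0.
under [X in _ = _ + X]eq_bigr do rewrite lift0 subSS addnS -addSn.
rewrite -IH -(sum_markov_op s (fun y => path_exp k s.+1 y _)) -big_split /=.
apply: eq_bigr => x _; rewrite -big_split /=; apply: eq_bigr => y _.
rewrite -mulrDr; congr (_ * _).
have := path_exp_lin k s.+1 y 1 1 (fun v => Psi (h s x :: v))
  (fun v => \sum_(w <- tails v) Psi w).
rewrite !mul1r => <-; congr path_exp; apply/funext => v.
by rewrite !mul1r big_cons.
Qed.

(* The maximal averages shrink along the path, so their conditional
   expectation is a supersolution of the backward equation. *)
Lemma path_exp_max_avg_super k s a x :
  markov_op s (fun y => path_exp k s.+1 y (max_avg a.+1 0)) x <=
  path_exp k.+1 s x (max_avg a 0).
Proof.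
apply: ler_sum => y _; rewrite ler_wpM2l // le_path_exp // => v v0.
exact: max_avg_behead.
Qed.

Lemma path_exp_head k s x : path_exp k.+1 s x (fun v => nth 0 v 0) = h s x.
Proof. by rewrite -[RHS](path_exp_cst k.+1 s x). Qed.

(** Telescoping: symmetry moves the operator from [v t] onto [H t.+1], where the supersolution
    property replaces it by [H t]. *)
Lemma sum_energy (v b H : nat -> I -> R) (j m : nat) (c : R) :
  (forall t x, 0 <= v t x) -> (forall t x, 0 <= H t x) ->
  (forall t x, (t < m)%N ->
    v t.+1 x + c * b t.+1 x <= markov_op (j + t) (v t) x) ->
  (forall t x, (t < m)%N -> markov_op (j + t) (H t.+1) x <= H t x) ->
  c * \sum_(t < m) \sum_x b t.+1 x * H t.+1 x <= \sum_x v 0 x * H 0 x.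
Proof.
move=> v0 H0 vb Hs.
suff : \sum_x v m x * H m x + c * \sum_(t < m) \sum_x b t.+1 x * H t.+1 x <=
    \sum_x v 0 x * H 0 x.
  by apply: le_trans; rewrite lerDr sumr_ge0 // => x _; rewrite mulr_ge0.
elim: m vb Hs => [|m IH] vb Hs; first by rewrite big_ord0 mulr0 addr0.
apply: le_trans (IH _ _); last 2 first.
- by move=> t x tm; rewrite vb // ltnW.
- by move=> t x tm; rewrite Hs // ltnW.
rewrite big_ord_recr /= mulrDr addrCA [leRHS]addrC lerD2l.
rewrite mulr_sumr -big_split /=.
apply: (@le_trans _ _ (\sum_x markov_op (j + m) (v m) x * H m.+1 x)).
  apply: ler_sum => x _; by rewrite mulrA -mulrDl ler_wpM2r // vb.
rewrite sum_markov_opC; apply: ler_sum => x _.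
by rewrite ler_wpM2l // Hs.
Qed.

Section Weighted.
Variables (L j : nat) (b v : nat -> I -> R) (c : R).
Hypothesis b_ge0 : forall t x, 0 <= b t x.
Hypothesis v_ge0 : forall t x, 0 <= v t x.
Hypothesis c_gt0 : 0 < c.
Hypothesis b_sub : forall t x, (j + t.+1 < L)%N ->
  b t.+1 x <= markov_op (j + t) (b t) x.
Hypothesis v_sub : forall t x, (j + t.+1 < L)%N ->
  v t.+1 x + c * b t.+1 x <= markov_op (j + t) (v t) x.

(** For [s + i < L] this is the expectation of [h (s + i)] at the position reached after [i] steps
    from [x]. As a path expectation, its sums over [i] can be compared with [max_avg] path by
    path. *)
Let Q s i x := path_exp (L - s) s x (fun w => nth 0 w i).

Let Q_ge0 s i x : 0 <= Q s i x.
Proof.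
rewrite path_exp_ge0 // => w w0.
have [iw|iw] := ltnP i (size w); last by rewrite nth_default.
exact: (all_nthP 0 w0).
Qed.

(** Each step back in time uses [b_sub] once and shifts the operator onto the weight by symmetry. *)
Lemma sum_mul_le_path_exp s i : (j + s + i < L)%N ->
  \sum_x b (s + i) x * h (j + s + i)%N x <= \sum_x b s x * Q (j + s) i x.
Proof.
elim: i s => [|i IH] s sL.
  rewrite !addn0 /Q; rewrite addn0 in sL.
  have -> : (L - (j + s) = (L - (j + s)).-1.+1)%N by rewrite prednK // subn_gt0.
  by under [leRHS]eq_bigr do rewrite path_exp_head.
have js : (j + s < L)%N by apply: leq_ltn_trans sL; rewrite leq_addr.
have -> : (s + i.+1 = s.+1 + i)%N by rewrite addnS addSn.
have e : (j + s + i.+1 = j + s.+1 + i)%N by rewrite !addnS !addSn.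
rewrite e; apply: le_trans (IH _ _) _; first by rewrite -e.
apply: (@le_trans _ _ (\sum_x markov_op (j + s) (b s) x * Q (j + s.+1) i x)).
  apply: ler_sum => x _; rewrite ler_wpM2r ?b_sub //.
  by apply: leq_ltn_trans sL; rewrite e leq_addr.
rewrite sum_markov_opC; apply: ler_sum => x _; rewrite ler_wpM2l // /Q.
have -> : (L - (j + s) = (L - (j + s.+1)).+1)%N by rewrite addnS subnSK.
by rewrite addnS.
Qed.

(** The [H_j(j + t)] of the overview: at time [j + t] a window starting at [j] has already [t]
    entries, all counted as 0. *)
Let H t x := path_exp (L - (j + t)) (j + t) x (max_avg t 0).

Let H_ge0 t x : 0 <= H t x.
Proof. by rewrite path_exp_ge0 // => w; exact: max_avg_ge0. Qed.

Lemma sum_path_exp_nth_le s x : \sum_(i < s.+1) Q (j + s) i x <= (s + s.+1)%:R * H s x.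
Proof.
rewrite -(path_exp_sum _ _ _ s.+1 (fun i w => nth 0 w i)) -path_expZ.
apply: le_path_exp => w w0.
exact: sum_le_max_avg.
Qed.

Lemma sum_weighted_le :
  \sum_(t < L - j | (0 < t)%N) \sum_x b t x * h (j + t)%N x <=
  4 / c * \sum_x v 0 x * path_exp (L - j) j x (max_avg 0 0).
Proof.
set m := (L - j)%N.
pose Y s i := \sum_x b s x * Q (j + s) i x.
have Y0 s i : 0 <= Y s i by apply: sumr_ge0 => x _; rewrite mulr_ge0.
(* At least [(t + 1) / 2] times [s] are admissible, and each of them bounds the left side by
   [Y s (t - s)]. *)
have avg (t : 'I_m) : (0 < t)%N -> \sum_x b t x * h (j + t)%N x <=
    \sum_(s < m | (s <= t)%N && (t <= s.*2)%N) 2 / t.+1%:R * Y s (t - s)%N.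
  move=> t0; rewrite -mulr_sumr mulrAC ler_pdivlMr ?ltr0n //.
  have jt : (j + t < L)%N by have := ltn_ord t; rewrite /m; lia.
  set X := \sum_x _.
  have X0 : 0 <= X by apply: sumr_ge0 => x _; rewrite mulr_ge0.
  apply: (@le_trans _ _ (2 * \sum_(s < m | (s <= t)%N && (t <= s.*2)%N) X)); last first.
    rewrite ler_wpM2l // ; apply: ler_sum => s /andP[st _].
    have := @sum_mul_le_path_exp s (t - s)%N.
    by rewrite -addnA subnKC // => /(_ jt).
  have := count_half (ltn_ord t); rewrite -(ler_nat R) => ct.
  rewrite mulrC; apply: le_trans (ler_wpM2r X0 ct) _.
  rewrite -muln2 natrM natr_sum mulrAC mulr_suml mulrC.
  by under eq_bigr do rewrite mul1r.
apply: le_trans (ler_sum _ avg) _.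
(* After the exchange [s <= t] turns [2 / (t + 1)] into [2 / (s + 1)]; moreover [0 < t <= 2 s]
   forces [0 < s]. *)
apply: (@le_trans _ _ (\sum_(s < m | (0 < s)%N)
    \sum_(t < m | (s <= t)%N && (t <= s.*2)%N) 2 / s.+1%:R * Y s (t - s)%N)).
  rewrite (exchange_big_dep (fun s : 'I_m => (0 < s)%N)) /=; last first.
    by move=> t s t0 /andP[_]; case: (s : nat) => //; rewrite leqn0; case: (t : nat) t0.
  apply: ler_sum => s s0; rewrite big_mkcond [leRHS]big_mkcond /=.
  apply: ler_sum => t _; case: (boolP ((s <= t)%N && (t <= s.*2)%N)) => [|_].
    case/andP => st _; rewrite (leq_trans s0 st) /=.
    rewrite ler_wpM2r // ler_pM2l // lef_pV2 ?posrE ?ltr0n // ler_nat ltnS //.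
  by rewrite andbF.
(* The 4 comes from [2 * (2 s + 1) <= 4 * (s + 1)]. *)
apply: (@le_trans _ _ (\sum_(s < m | (0 < s)%N) 4 * \sum_x b s x * H s x)).
  apply: ler_sum => s _; rewrite -mulr_sumr.
  apply: le_trans (ler_wpM2l _ (ler_sum_half_range s m (Y0 s))) _ => //.
  rewrite exchange_big /= mulr_sumr mulr_sumr; apply: ler_sum => x _.
  rewrite -mulr_sumr mulrCA [leRHS]mulrCA ler_wpM2l //.
  apply: le_trans (ler_wpM2l _ (sum_path_exp_nth_le s x)) _ => //.
  rewrite mulrA ler_wpM2r // mulrAC ler_pdivrMr ?ltr0n //.
  by rewrite -!natrM ler_nat; lia.
rewrite -mulr_sumr -mulrA ler_pM2l // mulrC ler_pdivlMr // mulrC.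
case mE : m => [|m']; first by rewrite big_ord0 mulr0 sumr_ge0 // => x _;
  rewrite mulr_ge0 // path_exp_ge0 // => w; exact: max_avg_ge0.
rewrite big_mkcond big_ord_recl /= add0r.
have := @sum_energy v b H j m' c v_ge0 H_ge0; rewrite /H addn0 -/m mE.
apply.
  by move=> t x tm; rewrite v_sub //; lia.
move=> t x tm; have -> : (L - (j + t) = (L - (j + t.+1)).+1)%N by lia.
by rewrite addnS path_exp_max_avg_super.
Qed.

End Weighted.
End Markov.

Lemma sum_triangle_reindex (R : realType) (L : nat) (F : nat -> nat -> R) :
  \sum_(n < L) \sum_(j < n) F j (n - j)%N =
  \sum_(j < L) \sum_(t < L - j | (0 < t)%N) F j t.
Proof.
elim: L => [|L IH]; first by rewrite !big_ord0.
rewrite big_ord_recr IH [RHS]big_ord_recr /= subSnn.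
rewrite [X in _ = _ + X]big_mkcond big_ord1 /= addr0 -big_split /=.
apply: eq_bigr => j _; rewrite [RHS]big_mkcond subSn ?(ltnW (ltn_ord j)) //.
rewrite [RHS]big_ord_recr -big_mkcond /=.
by rewrite subn_gt0 ltn_ord.
Qed.

(** * The square function estimate on a finite state space *)

Section SquareFunction.
Context {R : realType} {I : finType}.
Variables (L : nat) (p : nat -> I -> I -> R) (b v : nat -> nat -> I -> R) (c : R).
Hypothesis p_ge0 : forall n x y, 0 <= p n x y.
Hypothesis p_sym : forall n x y, p n x y = p n y x.
Hypothesis p_sum1 : forall n x, \sum_y p n x y = 1.
Hypothesis b_ge0 : forall j t x, 0 <= b j t x.
Hypothesis v_ge0 : forall j t x, 0 <= v j t x.
Hypothesis c_gt0 : 0 < c.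
Hypothesis b_sub : forall j t x, (j + t.+1 < L)%N ->
  b j t.+1 x <= markov_op p (j + t) (b j t) x.
Hypothesis v_sub : forall j t x, (j + t.+1 < L)%N ->
  v j t.+1 x + c * b j t.+1 x <= markov_op p (j + t) (v j t) x.

(** The energy inequality with the constant weight 1, summed over the starting times. *)
Lemma sum_square_function1 :
  \sum_(n < L) \sum_x \sum_(j < n) b j (n - j)%N x <=
  c^-1 * \sum_(j < L) \sum_x v j 0 x.
Proof.
under eq_bigr do rewrite exchange_big.
rewrite (sum_triangle_reindex L (fun j t => \sum_x b j t x)) mulr_sumr.
apply: ler_sum => j _; rewrite ler_pdivlMl //.
have jL := ltn_ord j; case mE : (L - j)%N => [|m]; first by lia.
rewrite big_mkcond big_ord_recl /= add0r.
have : c * \sum_(t < m) \sum_x b j t.+1 x * 1 <= \sum_x v j 0 x * 1.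
  apply: (@sum_energy _ _ p p_sym (v j) (b j) (fun=> fun=> 1) j m c) => // t x tm.
    by rewrite v_sub //; lia.
  by rewrite /markov_op; under eq_bigr do rewrite mulr1; rewrite p_sum1.
under [X in c * X]eq_bigr do under eq_bigr do rewrite mulr1.
by under [X in _ <= X]eq_bigr do rewrite mulr1.
Qed.

Lemma sum_square_function_weighted (h : nat -> I -> R) :
  (forall n x, 0 <= h n x) ->
  \sum_(n < L) \sum_x (\sum_(j < n) b j (n - j)%N x) * h n x <=
  4 / c * \sum_(j < L) \sum_x v j 0 x * path_exp p h (L - j) j x (max_avg 0 0).
Proof.
move=> h0.
rewrite (eq_bigr (fun n : 'I_L =>
    \sum_(j < n) \sum_x b j (n - j)%N x * h (j + (n - j))%N x)).
  rewrite (sum_triangle_reindex L (fun j t => \sum_x b j t x * h (j + t)%N x)) mulr_sumr.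
  by apply: ler_sum => j _; apply: sum_weighted_le => // t x; [exact: b_sub|exact: v_sub].
move=> n _; rewrite exchange_big; apply: eq_bigr => x _.
by rewrite mulr_suml; apply: eq_bigr => j _; rewrite subnKC // ltnW.
Qed.

(** The maximal inequality [HC] is applied along each path; summation over tails then turns both of
    its sides into one expectation per starting time. *)
Lemma sum_path_exp_max_avg (r C : R) (h : nat -> I -> R) :
  0 <= C -> (forall n x, 0 <= h n x) ->
  (forall w, nneg_seq w ->
    \sum_(u <- tails w) max_avg 0 0 u `^ r <= C * \sum_(u <- tails w) head 0 u `^ r) ->
  \sum_(j < L) \sum_x path_exp p h (L - j) j x (fun w => max_avg 0 0 w `^ r) <=
  C * \sum_(j < L) \sum_x h j x `^ r.
Proof.
move=> C0 h0 HC.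
have := sum_path_exp_tails p_sym p_sum1 h L 0 (fun w => max_avg 0 0 w `^ r).
under [RHS]eq_bigr do rewrite add0n.
move=> <-.
have -> : \sum_(j < L) \sum_x h j x `^ r =
    \sum_(j < L) \sum_x path_exp p h (L - j) (0 + j) x (fun w => head 0 w `^ r).
  apply: eq_bigr => j _; apply: eq_bigr => x _; rewrite add0n.
  have -> : (L - j = (L - j).-1.+1)%N by rewrite prednK // subn_gt0.
  by rewrite -[LHS](path_exp_cst p_sum1 h (L - j).-1.+1 j x).
rewrite -(sum_path_exp_tails p_sym p_sum1) mulr_sumr; apply: ler_sum => x _.
by rewrite -path_expZ; apply: le_path_exp.
Qed.

End SquareFunction.

(** [N] has to be uniform in the state space, the horizon and the kernel, because the boxes used
    later depend on the time window and on the data. *)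
Definition square_function_estimate (R : realType) (q c N : R) : Prop :=
  forall (I : finType) (L : nat) (p : nat -> I -> I -> R)
    (b v : nat -> nat -> I -> R),
    (forall n x y, 0 <= p n x y) -> (forall n x y, p n x y = p n y x) ->
    (forall n x, \sum_y p n x y = 1) ->
    (forall j t x, 0 <= b j t x) -> (forall j t x, 0 <= v j t x) ->
    (forall j t x, (j + t.+1 < L)%N ->
      b j t.+1 x <= markov_op p (j + t) (b j t) x) ->
    (forall j t x, (j + t.+1 < L)%N ->
      v j t.+1 x + c * b j t.+1 x <= markov_op p (j + t) (v j t) x) ->
    \sum_(n < L) \sum_x (\sum_(j < n) b j (n - j)%N x) `^ q <=
    N * \sum_(j < L) \sum_x v j 0 x `^ q.

Lemma square_function_bound (R : realType) (q c : R) : 1 <= q -> 0 < c ->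
  exists2 N : R, 0 <= N & square_function_estimate q c N.
Proof.
(* At [q = 1] the conjugate exponent degenerates, and the unweighted energy inequality applies
   directly. *)
move=> q1 c0; case: (eqVneq q 1) => [->|qn1].
  exists c^-1; first by rewrite invr_ge0 ltW.
  move=> I L p b v p0 ps p1 b0 v0 bs vs.
  under eq_bigr => n _ do under eq_bigr => x _ do rewrite powRr1 ?sumr_ge0 //.
  under [X in _ <= _ * X]eq_bigr => n _ do under eq_bigr => x _ do rewrite powRr1 //.
  exact: sum_square_function1 ps p1 v0 c0 vs.
have {qn1}q1 : 1 < q by rewrite lt_neqAle eq_sym qn1.
have q0 : 0 < q by rewrite (lt_trans _ q1).
have s0 : 0 < q - 1 by rewrite subr_gt0.
(* The exponent conjugate to [q]: the weight [A ^ (q - 1)] raised to [r] is [A ^ q]. *)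
pose r := q / (q - 1).
have r1 : 1 < r by rewrite /r ltr_pdivlMr // mul1r ltrBlDr ltrDl.
have [C C0 HC] := max_avg_strong_type r1.
(* Chosen so that, after the factors [C] of the maximal inequality and [4 / c] of the weighted
   bound, [SA] reappears with coefficient 1/2. *)
have e0 : 0 < c / (8 * C) by rewrite divr_gt0 // mulr_gt0.
have [D D0 HD] := ex_young q1 e0.
exists (8 / c * D); first by rewrite mulr_ge0 ?divr_ge0 // ltW.
move=> I L p b v p0 ps p1 b0 v0 bs vs.
pose A n x := \sum_(j < n) b j (n - j)%N x.
pose h n x := A n x `^ (q - 1).
have A0 n x : 0 <= A n x by apply: sumr_ge0.
have h0 n x : 0 <= h n x by apply: powR_ge0.
have hr n x : h n x `^ r = A n x `^ q.
  by rewrite /h -powRrM /r mulrCA divff ?mulr1 // gt_eqF.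
pose SA := \sum_(n < L) \sum_x A n x `^ q.
pose SV := \sum_(j < L) \sum_x v j 0 x * path_exp p h (L - j) j x (max_avg 0 0).
have E1 : SA <= 4 / c * SV.
  rewrite (le_trans _ (sum_square_function_weighted p0 ps p1 b0 v0 c0 bs vs h0)) //.
  apply: ler_sum => n _; apply: ler_sum => x _.
  by rewrite -/(A n x) /h powRM_subr1.
change (SA <= 8 / c * D * \sum_(j < L) \sum_x v j 0 x `^ q).
have E2 : SV <= \sum_(j < L) \sum_x
    (D * v j 0 x `^ q +
     c / (8 * C) * path_exp p h (L - j) j x (fun w => max_avg 0 0 w `^ r)).
  apply: ler_sum => j _; apply: ler_sum => x _.
  have := path_exp_lin p h (L - j) j x (D * v j 0 x `^ q) (c / (8 * C)) (fun=> 1)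
    (fun w => max_avg 0 0 w `^ r).
  rewrite (path_exp_cst p1) mulr1 => <-; rewrite -path_expZ.
  apply: le_path_exp => // w w0.
  have M0 := @max_avg_ge0 R 0 0 w (lexx 0) w0.
  (* Young's inequality on each path, with [b] the power [1 / (q - 1)] of the maximal average [M]:
     then [b ^ (q - 1) = M] and [b ^ q = M ^ r]. *)
  have := HD (v j 0 x) (max_avg 0 0 w `^ (q - 1)^-1) (v0 _ _ _) (powR_ge0 _ _).
  rewrite -!powRrM mulVf ?gt_eqF // powRr1 // [_^-1 * q]mulrC -/r.
  by rewrite addrC.
have E3 := sum_path_exp_max_avg L p0 ps p1 (ltW C0) h0 HC.
set SP := \sum_(j < L) _ in E3.
have {}E3 : SP <= C * SA.
  apply: le_trans E3 _; rewrite ler_pM2l //.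
  by apply: ler_sum => n _; apply: ler_sum => x _; rewrite hr.
set SG := \sum_(j < L) \sum_x v j 0 x `^ q.
have {}E2 : SV <= D * SG + c / (8 * C) * SP.
  apply: le_trans E2 _; rewrite !mulr_sumr -big_split /=.
  by apply: ler_sum => j _; rewrite !mulr_sumr -big_split.
have {E2 E3}E2 : SV <= D * SG + c / 8 * SA.
  apply: le_trans E2 _; rewrite lerD2l.
  apply: le_trans (ler_wpM2l (ltW e0) E3) _.
  by rewrite le_eqVlt; apply/orP; left; apply/eqP; field; rewrite gt_eqF.
have : SA <= 4 / c * (D * SG + c / 8 * SA).
  by apply: le_trans E1 _; rewrite ler_pM2l // divr_gt0.
have -> : 4 / c * (D * SG + c / 8 * SA) = 4 / c * D * SG + SA / 2.
  by field; rewrite gt_eqF.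
have -> : 8 / c * D * SG = 2 * (4 / c * D * SG) by field; rewrite gt_eqF.
lra.
Qed.

(** * Extended sums compared with finite sums *)

Section EsumFinite.
Context {R : realType}.

Lemma fsume_image_fin (T : finType) (K : choiceType) (phi : T -> K) (f : K -> \bar R) :
  injective phi ->
  (\sum_t f (phi t) = \sum_(k \in [set` [seq phi t | t <- enum T]]) f k)%E.
Proof.
move=> phiI; transitivity (\sum_(k <- [seq phi t | t <- enum T]) f k)%E.
  by rewrite big_map big_enum.
by apply: fsbig_seq; rewrite map_inj_uniq ?enum_uniq.
Qed.

Lemma sum_inj_le_esum (T : finType) (K : choiceType) (phi : T -> K) (f : K -> \bar R) :
  injective phi -> (\sum_t f (phi t) <= \esum_(k in [set: K]) f k)%E.
Proof.
move=> phiI; apply: esum_ge; exists [set` [seq phi t | t <- enum T]].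
  by split => //; exact: finite_seq.
by rewrite fsume_image_fin.
Qed.

Lemma fsume_le_sum_inj (T : finType) (K : choiceType) (phi : T -> K)
    (f : K -> \bar R) (F : set K) :
  injective phi -> (forall k, (0 <= f k)%E) -> finite_set F ->
  (forall k, F k -> exists t, phi t = k) ->
  (\sum_(k \in F) f k <= \sum_t f (phi t))%E.
Proof.
move=> phiI f0 Ff Fphi; rewrite fsume_image_fin //.
apply: lee_fsum_nneg_subset => //; apply/subsetP => k /Fphi [t <-] /=.
by rewrite map_f // mem_enum.
Qed.

(** Meant for the sum over all past times, whose terms vanish before the support of [g]. *)
Lemma esum_le_int (a : int -> R) (m0 : int) (N : nat) :
  (forall j, 0 <= a j) -> (forall j, j < m0 -> a j = 0) ->
  (\esum_(j in [set j : int | (j <= (m0 + N%:Z) - 1)%R]) (a j)%:E =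
   (\sum_(i < N) a (m0 + i%:Z))%:E)%E.
Proof.
move=> a0 am.
rewrite (esumID [set j | m0 <= j]) => [|j _]; last by rewrite lee_fin.
rewrite [X in (_ + X)%E]esum1 ?adde0; last first.
  by move=> j [_ /negP]; rewrite -ltNge => /am ->.
set s := [seq m0 + i%:Z | i <- iota 0 N].
have -> : [set j | (j <= m0 + N%:Z - 1)%R] `&` [set j | m0 <= j] = [set` s].
  apply/seteqP; split => j /=.
    move=> [jN mj]; apply/mapP; exists (absz (j - m0)); last by lia.
    by rewrite mem_iota; lia.
  by case/mapP => i; rewrite mem_iota => /andP[_ iN] ->; split; lia.
rewrite esum_fset; [|exact: finite_seq|by move=> j _; rewrite lee_fin].
transitivity (\sum_(j <- s) (a j)%:E)%E.
  by apply/esym/fsbig_seq; rewrite map_inj_uniq ?iota_uniq // => i i' /addrI [].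
by rewrite big_map -sumEFin -(big_mkord xpredT (fun i => (a (m0 + i%:Z))%:E))
  /index_iota subn0.
Qed.
End EsumFinite.

(** * One step of the lazy walk on the lattice *)

Section Walk.
Context {R : realType} {d d1 : nat}.
Variables (l : 'I_d1 -> 'rV[int]_d) (rho : R).
Implicit Types (lam : 'I_d1 -> R) (f : 'rV[int]_d -> R) (x : 'rV[int]_d).

Definition walk_op lam f x : R :=
  f x + rho * \sum_(k < d1) lam k * lat_diff2 (l k) f x.

Definition walk_hold lam : R := 1 - 2 * rho * \sum_(k < d1) lam k.

(** Shows the operator as an average with weight [walk_hold] on staying and [rho * lam k] on each of
    the jumps by [l k] and [- l k]; positivity is read off from this form. *)
Lemma walk_opE lam f x : walk_op lam f x =
  walk_hold lam * f x + \sum_(k < d1) rho * lam k * (f (x + l k) + f (x - l k)).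
Proof.
rewrite /walk_op /walk_hold mulrBl mul1r -addrA; congr (_ + _).
rewrite mulr_sumr [2 * rho * _]mulr_sumr mulr_suml -sumrN -big_split /=.
by apply: eq_bigr => k _; rewrite /lat_diff2; ring.
Qed.

Lemma walk_opD lam f g x :
  walk_op lam (fun y => f y + g y) x = walk_op lam f x + walk_op lam g x.
Proof.
rewrite !walk_opE mulrDr addrACA; congr (_ + _); rewrite -big_split /=.
by apply: eq_bigr => k _; ring.
Qed.

Lemma walk_opZ lam c f x :
  walk_op lam (fun y => c * f y) x = c * walk_op lam f x.
Proof.
rewrite !walk_opE mulrDr mulrCA; congr (_ + _); rewrite mulr_sumr.
by apply: eq_bigr => k _; ring.
Qed.

Lemma walk_op_cst lam c x : walk_op lam (fun=> c) x = c.
Proof.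
rewrite /walk_op big1 ?mulr0 ?addr0 // => k _.
by rewrite /lat_diff2 (_ : c - 2 * c + c = 0) ?mulr0 //; ring.
Qed.

Lemma walk_op_shift lam f e x :
  walk_op lam (fun y => f (y + e)) x = walk_op lam f (x + e).
Proof.
by rewrite !walk_opE; congr (_ + _); apply: eq_bigr => k _;
  rewrite ![x + e + _]addrAC.
Qed.

Lemma walk_op_diff lam f e x :
  walk_op lam (lat_diff e f) x = lat_diff e (walk_op lam f) x.
Proof.
have -> : lat_diff e f = (fun y => f (y + e) + -1 * f y).
  by apply/funext => y; rewrite mulN1r.
by rewrite walk_opD walk_opZ walk_op_shift mulN1r.
Qed.

(** Second moment equals squared mean plus variance, by linearity and invariance of constants. *)
Lemma walk_op_variance lam f x : walk_op lam (fun y => f y ^+ 2) x =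
  walk_op lam f x ^+ 2 + walk_op lam (fun y => (f y - walk_op lam f x) ^+ 2) x.
Proof.
set m := walk_op lam f x.
have -> : (fun y => (f y - m) ^+ 2) =
    (fun y => f y ^+ 2 + (- (2 * m) * f y + m ^+ 2)).
  by apply/funext => y; ring.
by rewrite walk_opD walk_opD walk_opZ walk_op_cst -/m; ring.
Qed.

Section Positive.
Variable lam : 'I_d1 -> R.
Hypothesis rho_ge0 : 0 <= rho.
Hypothesis lam_ge0 : forall k, 0 <= lam k.
Hypothesis hold_ge0 : 0 <= walk_hold lam.

Lemma walk_op_ge_hold f x : (forall y, 0 <= f y) ->
  walk_hold lam * f x <= walk_op lam f x.
Proof.
move=> f0; rewrite walk_opE lerDl sumr_ge0 // => k _.
by rewrite !mulr_ge0 ?addr_ge0.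
Qed.

Lemma walk_op_ge_step f x k : (forall y, 0 <= f y) ->
  rho * lam k * f (x + l k) <= walk_op lam f x.
Proof.
move=> f0; rewrite walk_opE (bigD1 k) //= mulrDr.
rewrite addrCA -addrA lerDl !addr_ge0 ?mulr_ge0 // sumr_ge0 // => i _.
by rewrite !mulr_ge0 ?addr_ge0.
Qed.

Lemma walk_op_sqr_le f x :
  walk_op lam f x ^+ 2 <= walk_op lam (fun y => f y ^+ 2) x.
Proof.
rewrite walk_op_variance lerDl; apply: le_trans (walk_op_ge_hold _ _).
  by rewrite mulr_ge0 ?sqr_ge0.
by move=> y; rewrite sqr_ge0.
Qed.

(* The variances of the steps out of [x] and of [x + l k] control the distances
   of [f (x + l k)] to the two means whose difference is on the left. *)
Lemma walk_op_dissipation f x k c0 : 0 <= c0 -> c0 <= walk_hold lam ->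
  c0 <= rho * lam k ->
  walk_op lam f x ^+ 2 + walk_op lam f (x + l k) ^+ 2
    + c0 / 2 * lat_diff (l k) (walk_op lam f) x ^+ 2 <=
  walk_op lam (fun y => f y ^+ 2 + f (y + l k) ^+ 2) x.
Proof.
move=> c00 c0h c0k.
rewrite walk_opD (walk_op_shift lam (fun y => f y ^+ 2)).
rewrite (walk_op_variance lam f x) (walk_op_variance lam f (x + l k)).
set m := walk_op lam f x; set m' := walk_op lam f (x + l k).
have h1 := @walk_op_ge_step (fun y => (f y - m) ^+ 2) x k (fun=> sqr_ge0 _).
have h2 := @walk_op_ge_hold (fun y => (f y - m') ^+ 2) (x + l k) (fun=> sqr_ge0 _).
have h3 := ler_wpM2r (sqr_ge0 (f (x + l k) - m)) c0k.
have h4 := ler_wpM2r (sqr_ge0 (f (x + l k) - m')) c0h.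
rewrite addrACA lerD2l /lat_diff -/m -/m'.
apply: le_trans (lerD (le_trans h3 h1) (le_trans h4 h2)).
rewrite -mulrDr -mulrA ler_wpM2l //.
set a := f _; rewrite -subr_ge0.
(* The parallelogram identity, which is where the factor 1/2 in [c0 / 2] comes from. *)
have -> : (a - m) ^+ 2 + (a - m') ^+ 2 - 2^-1 * (m' - m) ^+ 2 =
    (a - m + (a - m')) ^+ 2 / 2 by field.
by rewrite divr_ge0 ?sqr_ge0.
Qed.

End Positive.
End Walk.

(** * Restriction of the walk to a finite box *)

Section BoxKernel.
Context {R : realType} {d d1 : nat}.
Variables (l : 'I_d1 -> 'rV[int]_d) (rho : R) (B : {fset 'rV[int]_d}).
Implicit Types (lam : 'I_d1 -> R) (f : 'rV[int]_d -> R) (z : 'rV[int]_d).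

(** Indicators are added up, so that coinciding, opposite or zero vectors [l k] accumulate their
    weights. *)
Definition step_weight lam z : R := (z == 0)%:R * walk_hold rho lam +
  \sum_(k < d1) rho * lam k * ((z == l k)%:R + (z == - l k)%:R).

(* The walk killed outside [B], with the lost mass put back on the diagonal. *)
Definition box_kernel lam (x y : B) : R :=
  step_weight lam (val y - val x) +
  (x == y)%:R * (1 - \sum_(z : B) step_weight lam (val z - val x)).

Lemma step_weightN lam z : step_weight lam (- z) = step_weight lam z.
Proof.
rewrite /step_weight oppr_eq0; congr (_ + _); apply: eq_bigr => k _.
by rewrite eqr_oppLR eqr_opp [in LHS]addrC.
Qed.

Lemma box_kernel_sym lam x y : box_kernel lam x y = box_kernel lam y x.
Proof.
rewrite /box_kernel -step_weightN opprB; congr (_ + _).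
by case: (eqVneq x y) => [->//|]; rewrite !mul0r.
Qed.

Lemma box_kernel_sum1 lam x : \sum_y box_kernel lam x y = 1.
Proof.
rewrite big_split /= -mulr_suml.
have -> : \sum_(y : B) (x == y)%:R = 1 :> R; last by rewrite mul1r subrKC.
rewrite (bigD1 x) //= eqxx big1 ?addr0 // => y.
by rewrite eq_sym => /negbTE ->.
Qed.

Lemma sum_box_shift f z a : (forall y, y \notin B -> f y = 0) ->
  \sum_(y : B) (val y - z == a)%:R * f (val y) = f (z + a).
Proof.
move=> fB; case: (boolP (z + a \in B)) => zB; last first.
  rewrite fB // big1 // => y _; case: eqP => [yz|_]; last by rewrite mul0r.
  by move: zB; rewrite -yz subrKC (valP y).
rewrite (bigD1 [` zB]%fset) //= addrAC subrr add0r eqxx mul1r big1 ?addr0 //.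
move=> y yz; case: eqP => [ya|_]; last by rewrite mul0r.
by case/eqP: yz; apply: val_inj; rewrite /= -ya subrKC.
Qed.

Lemma sum_step_weight lam f z : (forall y, y \notin B -> f y = 0) ->
  \sum_(y : B) step_weight lam (val y - z) * f (val y) = walk_op l rho lam f z.
Proof.
move=> fB; rewrite walk_opE.
under eq_bigr do rewrite mulrDl mulrAC mulr_suml.
rewrite big_split /= -mulr_suml sum_box_shift // addr0 mulrC; congr (_ + _).
rewrite exchange_big /=; apply: eq_bigr => k _.
rewrite -(sum_box_shift z (l k) fB) -(sum_box_shift z (- l k) fB).
rewrite -big_split mulr_sumr; apply: eq_bigr => y _ /=; ring.
Qed.

Section Positive.
Variable lam : 'I_d1 -> R.
Hypothesis rho_ge0 : 0 <= rho.
Hypothesis lam_ge0 : forall k, 0 <= lam k.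
Hypothesis hold_ge0 : 0 <= walk_hold rho lam.

(** The missing mass is the walk operator applied to the indicator of the complement of [B], hence
    nonnegative. *)
Lemma sum_step_weight_le1 z : \sum_(y : B) step_weight lam (val y - z) <= 1.
Proof.
pose f y : R := (y \in B)%:R.
have -> : \sum_(y : B) step_weight lam (val y - z) =
    \sum_(y : B) step_weight lam (val y - z) * f (val y).
  by apply: eq_bigr => y _; rewrite /f (valP y) mulr1.
rewrite sum_step_weight => [|y /negbTE yB]; last by rewrite /f yB.
rewrite -subr_ge0 -(walk_op_cst l rho lam 1 z) -mulN1r -walk_opZ -walk_opD.
have f1 y : 0 <= 1 + -1 * f y by rewrite /f; case: (y \in B) => /=; lra.
by apply: le_trans (walk_op_ge_hold l rho_ge0 lam_ge0 z f1); rewrite mulr_ge0.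
Qed.

Lemma box_kernel_ge0 x y : 0 <= box_kernel lam x y.
Proof.
rewrite /box_kernel addr_ge0 ?mulr_ge0 ?ler0n ?subr_ge0 ?sum_step_weight_le1 //.
rewrite /step_weight addr_ge0 ?mulr_ge0 ?ler0n // sumr_ge0 // => k _.
by rewrite !mulr_ge0 ?addr_ge0 ?ler0n.
Qed.

(** Killing loses nothing on an [f] supported in [B], and the mass put back on the diagonal only
    adds a nonnegative term. *)
Lemma walk_op_le_box f (x : B) : (forall y, 0 <= f y) ->
  (forall y, y \notin B -> f y = 0) ->
  walk_op l rho lam f (val x) <= \sum_y box_kernel lam x y * f (val y).
Proof.
move=> f0 fB; rewrite -sum_step_weight //; apply: ler_sum => y _.
rewrite ler_wpM2r // lerDl mulr_ge0 ?ler0n // subr_ge0.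
exact: sum_step_weight_le1.
Qed.

End Positive.
End BoxKernel.

(** * Finite propagation, convolution and heat solutions *)

Lemma finite_support_walk_op (R : realType) (d d1 : nat) (l : 'I_d1 -> 'rV[int]_d)
    (rho : R) (lam : 'I_d1 -> R) (f : 'rV[int]_d -> R) :
  finite_set [set x | f x != 0] ->
  finite_set [set x | walk_op l rho lam f x != 0].
Proof.
move=> ff; set S := [set x | f x != 0] in ff.
apply: (@sub_finite_set _ _ (S `|` \bigcup_(k in [set: 'I_d1])
    ((fun y => y - l k) @` S `|` (fun y => y + l k) @` S))).
  move=> x /= wx; apply: contrapT => /not_orP[/negP/negPn/eqP fx nS].
  move/negP: wx; apply; rewrite walk_opE fx mulr0 add0r big1 // => k _.
  suff [-> ->] : f (x + l k) = 0 /\ f (x - l k) = 0 by rewrite addr0 mulr0.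
  split; apply: contrapT => /eqP fk; apply: nS; exists k => //.
    by left; exists (x + l k) => //; rewrite addrK.
  by right; exists (x - l k) => //; rewrite subrK.
rewrite finite_setU; split => //; apply: bigcup_finite => // k _.
by rewrite finite_setU; split; apply: finite_image.
Qed.

Section Convolution.
Context {R : realType} {d d1 : nat}.
Variables (l : 'I_d1 -> 'rV[int]_d) (rho : R).
Implicit Types (f gam : 'rV[int]_d -> R) (x : 'rV[int]_d).

Lemma lat_convE f gam x : finite_set [set y | gam y != 0] ->
  lat_conv f gam x = \sum_(y <- fset_set [set y | gam y != 0]) f (x - y) * gam y.
Proof.
move=> fg; apply: fsbigTE => y; rewrite in_fset_set // notin_setE /=.
by move/negP/negPn/eqP => ->; rewrite mulr0.
Qed.

Lemma lat_conv_diff e f gam x : finite_set [set y | gam y != 0] ->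
  lat_conv (lat_diff e f) gam x = lat_diff e (lat_conv f gam) x.
Proof.
move=> fg; rewrite /(lat_diff e (lat_conv _ _)) !lat_convE // -sumrB.
by apply: eq_bigr => y _; rewrite /lat_diff mulrBl addrAC.
Qed.

(** The step operator is a combination of translations, with which convolution commutes. *)
Lemma lat_conv_walk_op lam f gam x : finite_set [set y | gam y != 0] ->
  lat_conv (walk_op l rho lam f) gam x = walk_op l rho lam (lat_conv f gam) x.
Proof.
move=> fg; rewrite [RHS]walk_opE !lat_convE // mulr_sumr.
under [X in _ = _ + X]eq_bigr => k _ do
  rewrite !lat_convE // -big_split /= mulr_sumr.
rewrite exchange_big -big_split /=; apply: eq_bigr => y _.
rewrite walk_opE mulrDl mulrA mulr_suml; congr (_ + _).
by apply: eq_bigr => k _; rewrite ![x + _ - y]addrAC; ring.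
Qed.

Lemma lat_conv_delta gam x : finite_set [set y | gam y != 0] ->
  lat_conv (fun y => (y == 0)%:R) gam x = gam x.
Proof.
move=> fg; rewrite lat_convE //.
under eq_bigr do rewrite subr_eq0.
case: (boolP (x \in fset_set [set y | gam y != 0])) => xS.
  rewrite (big_rem x) //= eqxx mul1r big_seq big1 ?addr0 // => y.
  rewrite mem_rem_uniq ?fset_uniq // inE eq_sym => /andP[/negbTE -> _].
  by rewrite mul0r.
have -> : gam x = 0.
  by move: xS; rewrite in_fset_set // notin_setE /= => /negP/negPn/eqP.
rewrite big_seq big1 // => y yS; case: eqP => [xy|_]; last by rewrite mul0r.
by rewrite xy yS in xS.
Qed.

End Convolution.

Lemma finite_set_int_bound (A : set int) : finite_set A ->
  exists M : nat, forall z, A z -> - M%:Z <= z < M%:Z.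
Proof.
case/finite_seqP => s ->; elim: s => [|z s [M HM]]; first by exists 0%N.
exists (maxn M (absz z).+1) => y; rewrite /= inE => /orP[/eqP ->|/HM]; lia.
Qed.

Lemma powRD_le (R : realType) (q a b : R) : 0 <= q -> 0 <= a -> 0 <= b ->
  (a + b) `^ q <= 2 `^ q * (a `^ q + b `^ q).
Proof.
move=> q0; wlog ab : a b / a <= b => [H|] a0 b0.
  case: (leP a b) => ab; first exact: H.
  by rewrite addrC [in leRHS]addrC H // ltW.
apply: (@le_trans _ _ ((2 * b) `^ q)).
  by apply: ge0_ler_powR; rewrite ?nnegrE ?addr_ge0 ?mulr_ge0 //; lra.
by rewrite powRM // ler_wpM2l ?powR_ge0 // lerDr powR_ge0.
Qed.

Section HeatSolution.
Context {R : realType} {d d1 : nat}.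
Variables (l : 'I_d1 -> 'rV[int]_d) (lam : 'I_d1 -> int -> R) (rho : R).
Variables (G : int -> int -> 'rV[int]_d -> R) (g : int * 'rV[int]_d -> R).
Hypothesis hG : heat_kernel l lam rho G.
Hypothesis hg : finite_set [set tx | g tx != 0].

Definition heat_sol (j n : int) (x : 'rV[int]_d) : R :=
  lat_conv (G j n) (fun y => g (j, y)) x.

Lemma finite_slice j : finite_set [set y | g (j, y) != 0].
Proof.
apply: sub_finite_set (finite_image snd hg) => y /= gy.
by exists (j, y).
Qed.

Lemma heat_sol_init j x : heat_sol j j x = g (j, x).
Proof.
rewrite /heat_sol; have -> : G j j = (fun y => (y == 0)%:R).
  by apply/funext => y; case: (hG j) => ->.
exact: lat_conv_delta (finite_slice j).
Qed.

Lemma heat_sol_step j n x : j <= n ->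
  heat_sol j (n + 1) x = walk_op l rho (lam ^~ n) (heat_sol j n) x.
Proof.
move=> jn; rewrite -(lat_conv_walk_op _ _ _ _ _ (finite_slice j)) /heat_sol.
congr lat_conv; apply/funext => y; case: (hG j) => _ /(_ n y jn) E.
by rewrite /walk_op -E subrKC.
Qed.

Lemma finite_heat_sol j (t : nat) :
  finite_set [set x | heat_sol j (j + t%:Z) x != 0].
Proof.
elim: t => [|t IH].
  rewrite addr0; apply: sub_finite_set (finite_slice j) => x /=.
  by rewrite heat_sol_init.
apply: sub_finite_set (finite_support_walk_op l rho (lam ^~ (j + t%:Z)) IH) => x /=.
by rewrite -addn1 PoszD addrA heat_sol_step // lerDl.
Qed.

End HeatSolution.

(** * The estimate on a space-time box *)

Section LocalBound.
Context {R : realType} {d d1 : nat}.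
Variables (l : 'I_d1 -> 'rV[int]_d) (lam : 'I_d1 -> int -> R) (rho : R).
Variables (G : int -> int -> 'rV[int]_d -> R) (g : int * 'rV[int]_d -> R).
Hypothesis hG : heat_kernel l lam rho G.
Hypothesis hg : finite_set [set tx | g tx != 0].
Variables (c0 : R) (i : 'I_d1).
Hypothesis c0_gt0 : 0 < c0.
Hypothesis rho_ge0 : 0 <= rho.
Hypothesis lam_ge0 : forall k t, 0 <= lam k t.
Hypothesis hold_ge : forall t, c0 <= walk_hold rho (lam ^~ t).
Hypothesis step_ge : forall t, c0 <= rho * lam i t.

Let U := heat_sol G g.

(** Over a finite time window all solutions live in one finite box, where [box_kernel] inherits
    Jensen's inequality and the dissipation inequality from the lattice walk. *)
Lemma heat_square_function_local (q N : R) :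
  square_function_estimate q (c0 / 2) N ->
  forall (m0 : int) (L : nat) (F : {fset 'rV[int]_d}),
  exists2 B : {fset 'rV[int]_d}, {subset F <= B} &
    \sum_(n < L) \sum_(x : B)
      (\sum_(j < n) lat_diff (l i) (U (m0 + j%:Z) (m0 + n%:Z)) (val x) ^+ 2) `^ q <=
    N * \sum_(j < L) \sum_(x : B)
      (g (m0 + j%:Z, val x) ^+ 2 + g (m0 + j%:Z, val x + l i) ^+ 2) `^ q.
Proof.
move=> HN m0 L F.
pose u (j t : nat) := U (m0 + j%:Z) (m0 + j%:Z + t%:Z).
pose S j t := [set x | u j t x != 0].
have Sf j t : finite_set (S j t) := finite_heat_sol hG hg _ _.
(* Both [b] and [v] evaluate [u] at [y + l i] too, so the supports shifted back by [l i] are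
   included. *)
pose D := \bigcup_(j in `I_L) \bigcup_(t in `I_L)
  (S j t `|` (fun y => y - l i) @` S j t) `|` [set` F].
have Df : finite_set D.
  rewrite finite_setU; split => //; apply: bigcup_finite => // j _.
  apply: bigcup_finite => // t _; rewrite finite_setU; split => //.
  exact: finite_image.
pose B := fset_set D.
have uB j t y : (j + t < L)%N -> y \notin B -> u j t y = 0 /\ u j t (y + l i) = 0.
  rewrite in_fset_set // notin_setE => jt yD.
  have [jL tL] : (j < L)%N /\ (t < L)%N by split; lia.
  split; apply: contrapT => /eqP uy; apply: yD; left; exists j => //; exists t => //.
    by left.
  by right; exists (y + l i) => //; rewrite addrK.
have ustep j t : u j t.+1 = walk_op l rho (lam ^~ (m0 + (j + t)%N%:Z)) (u j t).
  apply/funext => x; rewrite /u -addn1 !PoszD !addrA.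
  by rewrite /U (heat_sol_step hG hg) // lerDl.
have hold0 t : 0 <= walk_hold rho (lam ^~ t) by apply: le_trans (ltW c0_gt0) _.
exists B.
  by move=> x xF; rewrite in_fset_set //; apply/mem_set; right.
pose b j t (x : B) := lat_diff (l i) (u j t) (val x) ^+ 2.
pose v j t (x : B) := u j t (val x) ^+ 2 + u j t (val x + l i) ^+ 2.
pose p n := @box_kernel _ _ _ l rho B (lam ^~ (m0 + n%:Z)).
have := HN B L p b v.
have -> : \sum_(n < L) \sum_(x : B) (\sum_(j < n) b j (n - j)%N x) `^ q =
    \sum_(n < L) \sum_(x : B)
      (\sum_(j < n) lat_diff (l i) (U (m0 + j%:Z) (m0 + n%:Z)) (val x) ^+ 2) `^ q.
  apply: eq_bigr => n _; apply: eq_bigr => x _; congr (_ `^ _).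
  apply: eq_bigr => j _; rewrite /b /u.
  by have -> : m0 + j%:Z + (n - j)%N%:Z = m0 + n%:Z by have := ltn_ord j; lia.
have -> : \sum_(j < L) \sum_(x : B) v j 0%N x `^ q =
    \sum_(j < L) \sum_(x : B)
      (g (m0 + j%:Z, val x) ^+ 2 + g (m0 + j%:Z, val x + l i) ^+ 2) `^ q.
  apply: eq_bigr => j _; apply: eq_bigr => x _; congr (_ `^ _).
  by rewrite /v /u addr0 /U !(heat_sol_init hG hg).
apply.
- by move=> n x y; apply: box_kernel_ge0.
- by move=> n x y; apply: box_kernel_sym.
- by move=> n x; apply: box_kernel_sum1.
- by move=> j t x; apply: sqr_ge0.
- by move=> j t x; rewrite addr_ge0 ?sqr_ge0.
- move=> j t x jt; rewrite /b ustep -walk_op_diff.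
  apply: le_trans (walk_op_sqr_le _ _ _ _ _ _) _ => //.
  apply: (@walk_op_le_box _ _ _ l rho B _ _ _ _
    (fun y => lat_diff (l i) (u j t) y ^+ 2)) => // y.
    exact: sqr_ge0.
  move=> yB; rewrite /lat_diff; have [|-> ->] := uB j t y _ yB; first by lia.
  by rewrite subrr expr0n.
- move=> j t x jt; rewrite /b /v ustep.
  apply: le_trans (walk_op_dissipation _ _ _ _ _ _ _ _ _) _ => //; first exact: ltW.
  apply: (@walk_op_le_box _ _ _ l rho B _ _ _ _
    (fun y => u j t y ^+ 2 + u j t (y + l i) ^+ 2)) => // y.
    by rewrite addr_ge0 ?sqr_ge0.
  move=> yB; have [|-> ->] := uB j t y _ yB; first by lia.
  by rewrite expr0n addr0.
Qed.

End LocalBound.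

(** * The estimate on the whole lattice *)

Theorem theorem3p18 (R : realType) (d d1 : nat) (hd : (1 <= d)%N)
    (hdd1 : (d <= d1)%N) (l : 'I_d1 -> 'rV[int]_d)
    (hl : forall k : 'I_d, l (widen_ord hdd1 k) = lat_basis k)
    (delta1s delta2s : R) (hdelta1s : 0 < delta1s)
    (hdelta12s : delta1s <= delta2s)
    (rho : R) (hrho0 : 0 < rho) (hrho : rho < (2 * d1%:R * delta2s)^-1)
    (p : R) (hp : 2 <= p) :
  exists N : R,
    forall (lam : 'I_d1 -> int -> R)
      (hlam : forall k t, delta1s <= lam k t <= delta2s)
      (ha : exists delta1 delta2 : R,
        [/\ 0 < delta1, 0 < delta2 &
            elliptic (diffusion l lam) delta1 delta2])
      (G : int -> int -> 'rV[int]_d -> R) (hG : heat_kernel l lam rho G)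
      (g : int * 'rV[int]_d -> R) (hg : finite_set [set tx | g tx != 0])
      (k : 'I_d),
      (\esum_(n in [set: int]) \esum_(x in [set: 'rV[int]_d])
          (\esum_(j in [set j : int | (j <= n - 1)%R])
             (`|lat_conv (lat_diff (lat_basis k) (G j n))
                (fun y => g (j, y)) x| ^+ 2)%:E)
          `^ (p / 2)
       <= N%:E * \esum_(tx in [set: int * 'rV[int]_d]) (`|g tx| `^ p)%:E)%E.
Proof.
have d2 : 0 < delta2s by apply: lt_le_trans hdelta12s.
have d10 : 0 < d1%:R :> R by rewrite ltr0n (leq_trans hd).
have kap : 0 < 1 - 2 * rho * (d1%:R * delta2s).
  move: hrho; rewrite -[_^-1]mul1r ltr_pdivlMr ?mulr_gt0 // subr_gt0.
  by have -> : rho * (2 * d1%:R * delta2s) = 2 * rho * (d1%:R * delta2s) by ring.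
(* A common lower bound for the probabilities of staying put and of the jump [e_k]; the bound on
   [rho] makes it positive. *)
pose c0 := Num.min (1 - 2 * rho * (d1%:R * delta2s)) (rho * delta1s).
have c00 : 0 < c0 by rewrite lt_min kap mulr_gt0.
have q1 : 1 <= p / 2 by lra.
have [N0 N00 HN] := square_function_bound q1 (divr_gt0 c00 (ltr0Sn _ 1)).
(* The power of 2 splits the sum of two squares of [g], at [x] and at [x + e_k]; the last 2 counts
   these two copies. *)
exists (N0 * (2 `^ (p / 2)) * 2) => lam hlam _ G hG g hg k.
set q := p / 2 in q1 HN *.
set E := (\esum_(tx in _) (`|g tx| `^ p)%:E)%E.
have lam0 i t : 0 <= lam i t.
  by case/andP: (hlam i t) => + _; apply: le_trans; exact: ltW.
have hold t : c0 <= walk_hold rho (lam ^~ t).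
  rewrite ge_min; apply/orP; left; rewrite lerD2l lerN2 ler_pM2l ?mulr_gt0 //.
  rewrite -[d1 in d1%:R]card_ord mulr_natl -sumr_const; apply: ler_sum => i _.
  by case/andP: (hlam i t).
have step t : c0 <= rho * lam (widen_ord hdd1 k) t.
  rewrite ge_min; apply/orP; right; rewrite ler_pM2l //.
  by case/andP: (hlam (widen_ord hdd1 k) t).
have loc := heat_square_function_local hG hg c00 (ltW hrho0) lam0 hold step HN.
rewrite esum_esum; last by move=> *; apply: poweR_ge0.
(* The double sum is a supremum over finite sets [F] of space-time points, on which [N0] does not
   depend. *)
apply: ge_ereal_sup => _ [F [Ff _] <-].
(* The time window from [-M] to [M - 1] covers [F] and the support of [g], so no source before it
   contributes. *)
have [M HM] : exists M : nat, forall z,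
    ([set tx.1 | tx in [set tx | g tx != 0]] `|` [set tx.1 | tx in F]) z ->
    - M%:Z <= z < M%:Z.
  by apply: finite_set_int_bound; rewrite finite_setU; split; apply: finite_image.
have [B FB HB] := loc (- M%:Z) (M + M)%N (fset_set [set tx.2 | tx in F]).
rewrite hl in HB.
set m0 : int := - M%:Z in HM HB.
pose phi (e : 'rV[int]_d) (t : 'I_(M + M) * B) : int * 'rV[int]_d :=
  (m0 + t.1%:Z, val t.2 + e).
have phiI e : injective (phi e).
  by move=> [n x] [n' x'] [] /addrI [] /val_inj -> /addIr /val_inj ->.
have gE e :
    ((\sum_(j < M + M) \sum_(x : B) `|g (m0 + j%:Z, val x + e)| `^ p)%:E <= E)%E.
  apply: le_trans (sum_inj_le_esum _ (phiI e)).
  by rewrite pair_bigA /= -sumEFin.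
apply: le_trans (fsume_le_sum_inj (phiI 0) _ Ff _) _.
- by move=> tx; apply: poweR_ge0.
- move=> [n x] nxF.
  have /andP[n1 n2] : m0 <= n < M%:Z by apply: HM; right; exists (n, x).
  have xB : x \in B.
    apply: FB; rewrite in_fset_set; last exact: finite_image.
    by apply/mem_set; exists (n, x).
  have nM : (absz (n - m0)%R < M + M)%N by move: n1 n2; rewrite /m0; clear; lia.
  exists (Ordinal nM, [` xB]%fset); rewrite /phi /= addr0; congr pair.
  by move: n1; rewrite /m0; clear; lia.
rewrite [leLHS](_ : _ = (\sum_(n < M + M) \sum_(x : B)
    (\sum_(j < n) lat_diff (lat_basis k) (heat_sol G g (m0 + j%:Z) (m0 + n%:Z))
      (val x) ^+ 2) `^ q)%:E); last first.
  rewrite pair_bigA /= -sumEFin; apply: eq_bigr => -[n x] _ /=.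
  rewrite addr0 esum_le_int.
  - rewrite poweR_EFin; congr (_ `^ _)%:E; apply: eq_bigr => j _.
    by rewrite real_normK ?num_real // (lat_conv_diff _ _ _ (finite_slice hg _)).
  - by move=> j; rewrite exprn_ge0.
  - move=> j jm; rewrite /lat_conv fsbig1 ?normr0 ?expr0n // => y _.
    suff -> : g (j, y) = 0 by rewrite mulr0.
    apply: contrapT => /eqP gjy.
    have /andP[mj _] : m0 <= j < M%:Z by apply: HM; left; exists (j, y).
    by move: jm; rewrite ltNge mj.
apply: (@le_trans _ _ ((N0 * 2 `^ q)%:E * (E + E))%E); last first.
  by rewrite [in leRHS]EFinM -muleA mule_natl mule2n.
have sq z : (z ^+ 2) `^ q = `|z| `^ p.
  rewrite -real_normK ?num_real // -powR_mulrn // -powRrM; congr (_ `^ _).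
  by rewrite /q mulrCA divff ?mulr1.
apply: (@le_trans _ _ ((N0 * 2 `^ q)%:E *
    ((\sum_(j < M + M) \sum_(x : B) `|g (m0 + j%:Z, val x + 0)| `^ p)%:E +
     (\sum_(j < M + M) \sum_(x : B) `|g (m0 + j%:Z, val x + lat_basis k)| `^ p)%:E))%E);
  last first.
  by rewrite lee_wpmul2l ?lee_fin ?mulr_ge0 ?powR_ge0 // leeD.
rewrite -EFinD -EFinM lee_fin; apply: le_trans HB _.
rewrite -mulrA ler_wpM2l // -big_split /= mulr_sumr; apply: ler_sum => j _.
rewrite -big_split /= mulr_sumr; apply: ler_sum => x _.
by rewrite addr0 -!sq powRD_le ?sqr_ge0 // (le_trans _ q1).
Qed.
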